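(* Complete Sequence Addition and Complete Sequence Multiplication are non-commutative in general. That is: (1) there exist a finite set $S=\{o_1,\dots,o_n\}$ of OIE instances (with an infeasibility assignment satisfying the standing axiom), reals $\alpha<\beta$ and index tuples $(i_1,\dots,i_n)$, $(j_1,\dots,j_n)$ of length $n$ such that $\oplus|_\alpha^\beta(o_{i_1},\dots,o_{i_n})\neq\oplus|_\alpha^\beta(o_{j_1},\dots,o_{j_n})$; (2) there exist a finite set $S=\{o_1,\dots,o_n\}$ of OIE instances (with an infeasibility assignment satisfying the standing axiom) and index tuples $(i_1,\dots,i_n)$, $(j_1,\dots,j_n)$ of length $n$ such that $\otimes(o_{i_1},\dots,o_{i_n})\neq\otimes(o_{j_1},\dots,o_{j_n})$.
   Context: Times are real numbers; a ''2-tuple'' is a pair $(x,y)$ of reals with $x<y$ (starting and ending timestamp). For a nonempty finite tuple of 2-tuples $T=((x_1,y_1),\dots,(x_m,y_m))$ put $\mathrm{bound}(T)=(\min_i x_i,\max_i y_i)$. An OIE (Optional Intervals Event) instance is a 4-tuple $o=(\mathcal C_o,\mathcal F_o,\mathcal I_o,\mathcal A_o)$ where $\mathcal C_o$ is a finite (possibly empty) tuple of OIE instances, $\mathcal F_o$ is a set of nonempty finite tuples of 2-tuples, $\mathcal I_o=\{\mathrm{bound}(T):T\in\mathcal F_o\}$, and $\mathcal A_o$ is a set of (labels of) atomic events. The void instance is $o_{\mathrm{void}}=((),\emptyset,\emptyset,\emptyset)$; every other instance has $\mathcal F_o,\mathcal I_o,\mathcal A_o$ nonempty. Two instances are equal iff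 all four components are equal. An index tuple of length $n$ is a tuple in which each of $1,\dots,n$ occurs exactly once. A permutation matrix $M$ acts on $n$-tuples (viewed as row vectors) on the right by reordering the entries, $T\mapsto T\cdot M$. For $S=\{o_1,\dots,o_n\}$ and an index tuple $\sigma=(i_1,\dots,i_n)$, let $N(S,\sigma)=\{(t_1,\dots,t_n): t_k\in\mathcal I_{o_{i_k}}\text{ for all }k\}$. External constraints determine an infeasible subset $\mathrm{Inf}(S,\sigma)\subseteq N(S,\sigma)$ (the infeasibility assignment); this is given data, subject only to the standing axiom: whenever $\sigma\cdot M=\tau$ for index tuples $\sigma,\tau$ of length $n>1$ and a permutation matrix $M$, the map $T\mapsto T\cdot M$ is a bijection from $\mathrm{Inf}(S,\sigma)$ onto $\mathrm{Inf}(S,\tau)$. Put $\mathrm{Feas}(S,\sigma)=N(S,\sigma)\setminus\mathrm{Inf}(S,\sigma)$. Domain filter: for a nonempty set $X$ of $n$-tuples of 2-tuples and reals $\alpha<\beta$, let $X'=\{T\in X: x\ge\alpha\text{ and }y\le\beta\text{ for every entry }(x,y)\text{ of }T\}$. Then $\mathrm{Dom}_\alpha^\beta(X)=X'$ if for every $k\in\{1,\dots,n\}$ some $T\in X'$ has $k$-th entry with first item $\alpha$ and some $T\in X'$ has $k$-th entry with second item $\beta$; otherwise $\mathrm{Dom}_\alpha^\beta(X)=\emptyset$. Ascending filter: for a set $X$ of tuples of 2-tuples, $\mathrm{Asc}(X)$ is the set of $T\in X$ such that for all positions $p<q$ the second item of the $p$-th entry of $T$ is $\le$ the first item of the $q$-th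 entry of $T$. Complete Sequence Addition $\oplus|_\alpha^\beta(o_{i_1},\dots,o_{i_n})$ (for $n\ge 2$) and Complete Sequence Multiplication $\otimes(o_{i_1},\dots,o_{i_n})$, with $\sigma=(i_1,\dots,i_n)$: write $\Phi=\mathrm{Dom}_\alpha^\beta$ for $\oplus|_\alpha^\beta$ and $\Phi=\mathrm{Asc}$ for $\otimes$. The result is $o_{\mathrm{void}}$ if $\bigcap_{k}\mathcal A_{o_{i_k}}\ne\emptyset$, or some $o_{i_k}=o_{\mathrm{void}}$, or $\mathrm{Feas}(S,\sigma)=\emptyset$, or $\Phi(\mathrm{Feas}(S,\sigma))=\emptyset$. Otherwise the result is $(\mathcal C,\mathcal F,\mathcal I,\mathcal A)$ with $\mathcal C=(o_{i_1},\dots,o_{i_n})$, $\mathcal F=\Phi(\mathrm{Feas}(S,\sigma))$, $\mathcal I=\{\mathrm{bound}(T):T\in\mathcal F\}$, $\mathcal A=\bigcup_k\mathcal A_{o_{i_k}}$. *)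

(* Defs.v *)
From HB Require Import structures.
From mathcomp Require Import all_boot all_order all_fingroup all_algebra.
From mathcomp Require Import boolp classical_sets functions reals.

Set Implicit Arguments.
Unset Strict Implicit.
Unset Printing Implicit Defensive.

Import Order.TTheory GRing.Theory Num.Theory.

Local Open Scope classical_set_scope.
Local Open Scope ring_scope.

Section OIE.
Variable R : realType.

(* A 2-tuple (x, y) is a raw pair; the condition x < y is imposed by [is_oie]
   on every tuple of [feas o], and is inherited by [ivals o]. *)

(* (min_i x_i, max_i y_i); the value at the empty sequence is irrelevant. *)
Definition bound (T : seq (R * R)) : R * R :=
  (\big[Num.min/(head (0, 0) T).1]_(p <- T) p.1,
   \big[Num.max/(head (0, 0) T).2]_(p <- T) p.2).

(* [L] is the universe of labels of atomic events. *)
Variable L : Type.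

Inductive oie : Type :=
  Oie of seq oie & set (seq (R * R)) & set (R * R) & set L.

Definition comps (o : oie) := let: Oie C _ _ _ := o in C.
Definition feas (o : oie) := let: Oie _ F _ _ := o in F.
Definition ivals (o : oie) := let: Oie _ _ V _ := o in V.
Definition labels (o : oie) := let: Oie _ _ _ A := o in A.

Definition oie_void : oie := Oie [::] set0 set0 set0.

Inductive is_oie : oie -> Prop :=
| Is_oie_void : is_oie oie_void
| Is_oie_nonvoid (o : oie) of
    (forall k, (k < size (comps o))%N -> is_oie (nth oie_void (comps o) k)) &
    (forall T, feas o T -> T <> [::] /\ {in T, forall p, p.1 < p.2}) &
    ivals o = bound @` feas o &
    feas o !=set0 & ivals o !=set0 & labels o !=set0 :
    is_oie o.

Section Family.
Variables (n : nat) (o : 'I_n -> oie).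

Definition is_index_tuple (sigma : n.-tuple 'I_n) : Prop :=
  forall i : 'I_n, count_mem i sigma = 1%N.

(* T . M for the permutation matrix M = perm_mx s, see [reorder_perm_mx]. *)
Definition reorder (X : Type) (s : 'S_n) (T : n.-tuple X) : n.-tuple X :=
  [tuple tnth T ((s^-1)%g k) | k < n].

Definition Nset (sigma : n.-tuple 'I_n) : set (n.-tuple (R * R)) :=
  [set t | forall k : 'I_n, ivals (o (tnth sigma k)) (tnth t k)].

(* Only the values of [Inf] at index tuples are meaningful. *)
Definition infeasibility_assignment
    (Inf : n.-tuple 'I_n -> set (n.-tuple (R * R))) : Prop :=
  (forall sigma, is_index_tuple sigma -> Inf sigma `<=` Nset sigma) /\
  ((1 < n)%N ->
   forall (sigma tau : n.-tuple 'I_n) (s : 'S_n),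
     is_index_tuple sigma -> is_index_tuple tau -> reorder s sigma = tau ->
     set_bij (Inf sigma) (Inf tau) (reorder s)).

Definition Feas (Inf : n.-tuple 'I_n -> set (n.-tuple (R * R)))
    (sigma : n.-tuple 'I_n) : set (n.-tuple (R * R)) :=
  Nset sigma `\` Inf sigma.

Definition dom_restrict (alpha beta : R) (X : set (n.-tuple (R * R))) :=
  [set T | X T /\
    forall k : 'I_n, alpha <= (tnth T k).1 /\ (tnth T k).2 <= beta].

Definition Dom (alpha beta : R) (X : set (n.-tuple (R * R))) :
    set (n.-tuple (R * R)) :=
  let X' := dom_restrict alpha beta X in
  if `[< forall k : 'I_n,
           (exists2 T, X' T & (tnth T k).1 = alpha) /\
           (exists2 T, X' T & (tnth T k).2 = beta) >]
  then X' else set0.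

Definition Asc (X : set (n.-tuple (R * R))) : set (n.-tuple (R * R)) :=
  [set T | X T /\
    forall p q : 'I_n, (p < q)%N -> (tnth T p).2 <= (tnth T q).1].

Definition complete_sequence
    (Phi : set (n.-tuple (R * R)) -> set (n.-tuple (R * R)))
    (Inf : n.-tuple 'I_n -> set (n.-tuple (R * R)))
    (sigma : n.-tuple 'I_n) : oie :=
  if `[< (\bigcap_(k : 'I_n) labels (o (tnth sigma k))) !=set0 \/
         (exists k : 'I_n, o (tnth sigma k) = oie_void) \/
         Feas Inf sigma = set0 \/
         Phi (Feas Inf sigma) = set0 >]
  then oie_void
  else
    let F := (fun T : n.-tuple (R * R) => tval T) @` Phi (Feas Inf sigma) in
    Oie [seq o i | i <- sigma] F (bound @` F)
        (\bigcup_(k : 'I_n) labels (o (tnth sigma k))).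

Definition cs_add (Inf : n.-tuple 'I_n -> set (n.-tuple (R * R)))
    (alpha beta : R) (sigma : n.-tuple 'I_n) : oie :=
  complete_sequence (Dom alpha beta) Inf sigma.

Definition cs_mul (Inf : n.-tuple 'I_n -> set (n.-tuple (R * R)))
    (sigma : n.-tuple 'I_n) : oie :=
  complete_sequence Asc Inf sigma.

End Family.
End OIE.

Lemma reorder_perm_mx (K : nzRingType) (n : nat) (s : 'S_n) (T : n.-tuple K) :
  \row_k tnth (reorder s T) k = (\row_k tnth T k) *m perm_mx s.
Proof.
apply/rowP => k; rewrite !mxE tnth_mktuple (bigD1 ((s^-1)%g k)) //=.
rewrite big1 => [|i ik]; first by rewrite !mxE permKV eqxx mulr1 addr0.
rewrite !mxE; case: eqP => [ski|]; last by rewrite mulr0.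
by rewrite -ski permK eqxx in ik.
Qed.

(* Main.v *)
Require Import Defs.
From mathcomp Require Import all_boot all_order all_fingroup all_algebra.
From mathcomp Require Import boolp classical_sets functions reals.

Local Open Scope ring_scope.

(** A non-void complete sequence records its operands, in order, as its first
    component, so over an injective family it determines the index tuple it was
    built from ([complete_sequence_inj]).  Hence any non-void value already
    witnesses non-commutativity: every other ordering gives a different result,
    void or not.

    It remains to exhibit a non-void addition and a non-void multiplication.  Two
    atomic instances with distinct labels, each occurring in exactly one interval,
    and no infeasible tuples leave a single feasible tuple [(I, J)].  The domain
    filter from 0 to 1 keeps it for [I = J = (0, 1)], and the ascending filter keeps
    it for [I = (0, 1)] and [J = (1, 2)]. *)

Import Order.TTheory GRing.Theory Num.Theory.
Local Open Scope classical_set_scope.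

Section CompleteSequence.
Context {R : realType} {L : Type} {n : nat} {o : 'I_n -> oie R L}.
Context {Phi : set (n.-tuple (R * R)) -> set (n.-tuple (R * R))}.
Context {Inf : n.-tuple 'I_n -> set (n.-tuple (R * R))}.

Lemma comps_complete_sequence (sigma : n.-tuple 'I_n) :
  complete_sequence o Phi Inf sigma <> oie_void R L ->
  comps (complete_sequence o Phi Inf sigma) = [seq o i | i <- sigma].
Proof. by rewrite /complete_sequence; case: ifP. Qed.

(** Both values are non-void, so both record their operands, and injectivity of
    [o] reads the indices off these. *)
Lemma complete_sequence_inj (sigma tau : n.-tuple 'I_n) :
  injective o -> complete_sequence o Phi Inf sigma <> oie_void R L ->
  complete_sequence o Phi Inf sigma = complete_sequence o Phi Inf tau ->
  sigma = tau.
Proof.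
move=> o_inj nvs est; have nvt := nvs; rewrite est in nvt.
apply/val_inj/(inj_map o_inj).
by rewrite -(comps_complete_sequence _ nvs) est comps_complete_sequence.
Qed.

Lemma complete_sequence_nonvoid (sigma : n.-tuple 'I_n) (T : n.-tuple (R * R)) :
  (0 < n)%N ->
  \bigcap_(k : 'I_n) labels (o (tnth sigma k)) = set0 ->
  (forall i, o i <> oie_void R L) ->
  Feas o Inf sigma T -> Phi (Feas o Inf sigma) T ->
  complete_sequence o Phi Inf sigma <> oie_void R L.
Proof.
move=> n_gt0 disj nv FT PT; rewrite /complete_sequence asboolF.
  (* The list of operands has length n > 0, while the void instance has none. *)
  move=> /(congr1 (size \o @comps R L)) /=; rewrite size_map size_tuple => n0.
  by rewrite n0 in n_gt0.
case=> [|[[k /nv//]|[F0|P0]]].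
- by rewrite disj => -[].
- by rewrite F0 in FT.
- by rewrite P0 in PT.
Qed.

End CompleteSequence.

Lemma infeasibility_assignment0 (R : realType) (L : Type) (n : nat)
    (o : 'I_n -> oie R L) :
  infeasibility_assignment o (fun=> set0).
Proof.
split=> [sigma _ //|_ sigma tau s _ _ _].
by split=> [T []|T U|T []]; rewrite ?in_set0.
Qed.

Section AtomicPair.
Context {R : realType} {L : Type}.

Definition atomic (l : L) (I : R * R) : oie R L :=
  Oie [::] [set [:: I]] [set I] [set l].

Lemma atomic_nonvoid (l : L) (I : R * R) : atomic l I <> oie_void R L.
Proof.
by move=> E; have : labels (oie_void R L) l by rewrite -E.
Qed.

Lemma is_oie_atomic (l : L) (I : R * R) : I.1 < I.2 -> is_oie (atomic l I).
Proof.
move=> ltI; apply: Is_oie_nonvoid => //=.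
- by move=> T ->; split=> // p; rewrite inE => /eqP ->.
- by rewrite image_set1 /bound !big_cons !big_nil minxx maxxx; case: I {ltI}.
- by exists [:: I].
- by exists I.
- by exists l.
Qed.

Context {l1 l2 : L} (hL : l1 <> l2).

(** The instances are told apart by their labels, so [I] and [J] may coincide. *)
Definition atomic_pair (I J : R * R) (i : 'I_2) : oie R L :=
  if i == ord0 then atomic l1 I else atomic l2 J.

Lemma atomic_pair_inj (I J : R * R) : injective (atomic_pair I J).
Proof.
have neq12 : atomic l1 I <> atomic l2 J.
  by move=> E; apply: hL; have : labels (atomic l2 J) l1 by rewrite -E.
move=> [[|[|//]] i2] [[|[|//]] j2] //=.
- by move=> _; apply: val_inj.
- by move=> /esym.
- by move=> _; apply: val_inj.
Qed.

Lemma is_oie_atomic_pair (I J : R * R) :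
  I.1 < I.2 -> J.1 < J.2 -> forall i, is_oie (atomic_pair I J i).
Proof.
by move=> ltI ltJ i; rewrite /atomic_pair; case: ifP => _; apply: is_oie_atomic.
Qed.

Definition index01 : 2.-tuple 'I_2 := [tuple ord0; ord_max].
Definition index10 : 2.-tuple 'I_2 := [tuple ord_max; ord0].

Lemma is_index_tuple01 : is_index_tuple index01.
Proof. by case=> -[|[|]]. Qed.

Lemma is_index_tuple10 : is_index_tuple index10.
Proof. by case=> -[|[|]]. Qed.

Lemma Feas_atomic_pair (I J : R * R) :
  Feas (atomic_pair I J) (fun=> set0) index01 [tuple I; J].
Proof. by split=> [[[|[|//]] k2]|[]]. Qed.

(** The labels are disjoint, the operands are non-void and [(I, J)] is feasible, so
    only the filter could make the first result void. *)
Lemma atomic_pair_noncommutative (I J : R * R)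
    (Phi : set (2.-tuple (R * R)) -> set (2.-tuple (R * R))) :
  Phi (Feas (atomic_pair I J) (fun=> set0) index01) [tuple I; J] ->
  complete_sequence (atomic_pair I J) Phi (fun=> set0) index01 <>
  complete_sequence (atomic_pair I J) Phi (fun=> set0) index10.
Proof.
move=> PT E; suff : index01 = index10 by move=> /(congr1 (@thead 1 _)).
apply: complete_sequence_inj E; first exact: atomic_pair_inj.
apply: complete_sequence_nonvoid (Feas_atomic_pair I J) PT => //.
- apply/seteqP; split=> [l /= lP|//]; apply: hL.
  by have /= <- := lP ord0 Logic.I; have /= <- := lP ord_max Logic.I.
- by move=> i; rewrite /atomic_pair; case: ifP => _; apply: atomic_nonvoid.
Qed.

End AtomicPair.

Theorem mainTheorem5 (R : realType) (L : Type) (l1 l2 : L) (hL : l1 <> l2) :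
  (exists (n : nat) (o : 'I_n -> oie R L)
          (Inf : n.-tuple 'I_n -> set (n.-tuple (R * R)))
          (alpha beta : R) (sigma tau : n.-tuple 'I_n),
      (1 < n)%N /\ injective o /\ (forall i, is_oie (o i)) /\
      infeasibility_assignment o Inf /\ alpha < beta /\
      is_index_tuple sigma /\ is_index_tuple tau /\
      cs_add o Inf alpha beta sigma <> cs_add o Inf alpha beta tau) /\
  (exists (n : nat) (o : 'I_n -> oie R L)
          (Inf : n.-tuple 'I_n -> set (n.-tuple (R * R)))
          (sigma tau : n.-tuple 'I_n),
      (1 < n)%N /\ injective o /\ (forall i, is_oie (o i)) /\
      infeasibility_assignment o Inf /\
      is_index_tuple sigma /\ is_index_tuple tau /\
      cs_mul o Inf sigma <> cs_mul o Inf tau).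
Proof.
have lt01 : (0 : R) < 1 by exact: ltr01.
have lt12 : (1 : R) < 2 by rewrite ltr1n.
split.
- pose u : R * R := (0, 1).
  exists 2, (@atomic_pair R L l1 l2 u u), (fun=> set0), 0, 1, index01, index10.
  split=> //; split; first exact: atomic_pair_inj.
  split; first exact: is_oie_atomic_pair.
  split; first exact: infeasibility_assignment0.
  split=> //; split; first exact: is_index_tuple01.
  split; first exact: is_index_tuple10.
  apply: (atomic_pair_noncommutative hL).
  have XT : dom_restrict 0 1 (Feas (@atomic_pair R L l1 l2 u u) (fun=> set0) index01)
      [tuple u; u].
    by split=> [|[[|[|//]] k2]]; [exact: Feas_atomic_pair|split|split].
  rewrite /Dom asboolT // => k.
  by split; exists [tuple u; u] => //; case: k => -[|[|//]] k2.
- exists 2, (@atomic_pair R L l1 l2 (0, 1) (1, 2)), (fun=> set0), index01, index10.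
  split=> //; split; first exact: atomic_pair_inj.
  split; first exact: is_oie_atomic_pair.
  split; first exact: infeasibility_assignment0.
  split; first exact: is_index_tuple01.
  split; first exact: is_index_tuple10.
  apply: (atomic_pair_noncommutative hL); split; first exact: Feas_atomic_pair.
  by case=> -[|[|//]] p2 [[|[|//]] q2].
Qed.
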